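(* Suppose $\mathcal Q$ is vertically unbounded, $m=1$ (i.e. $\mathcal Q$ consists of polynomials of degree one) and $v(p)\in H$. Then $d=1$ and $B^{ct}=\{1,2,\dots,D\}$.
   Context: Let $(K,v)$ be a valued field and $p$ the characteristic exponent of its residue field ($p=1$ if the residue characteristic is $0$, otherwise $p$ is the residue characteristic); $v(p)$ denotes the value of $p\cdot1\in K$ (so $v(p)=\infty$ if $\mathrm{char}K=p>0$). Let $\Gamma$ be the divisible hull of $vK$, embedded in a divisible ordered abelian group $\Lambda$. Let $\nu\colon K[x]\to\Lambda\cup\{\infty\}$ be a valuation extending $v$ which is well-specified, i.e. it is not the case that simultaneously $\nu^{-1}(\infty)=0$, the value group of $\nu$ modulo $\Gamma$ is torsion, and the residue field of $\nu$ is algebraic over that of $v$. For $s\ge0$ let $\partial_s$ be the $s$-th Hasse–Schmidt derivative, defined by $f(x+y)=\sum_{s\ge0}(\partial_sf)y^s$. For nonconstant $f$ with $\nu(f)<\infty$ the level is $\epsilon_\nu(f)=\max\{(\nu(f)-\nu(\partial_sf))/s: s\ge1\}$; $\epsilon_\nu(a)=-\infty$ for $a\in K$. A monic $Q\in K[x]$ is a key polynomial for $\nu$ if $\epsilon_\nu(f)<\epsilon_\nu(Q)$ whenever $\deg f<\deg Q$. For monic $Q$, each $f$ has a unique $Q$-expansion $f=\sum_{i\ge0}f_{Q,i}Q^i$ with $\deg f_{Q,i}<\deg Q$; set $\nu_Q(f)=\min_i\nu(f_{Q,i}Q^i)$, $S_Q(f)=\{i:\nu(f_{Q,i}Q^i)=\nu_Q(f)\}$,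 $\deg_Qf=\max S_Q(f)$. Fix $m\ge1$ such that the set $\Psi_m$ of key polynomials of degree $m$ for $\nu$ is nonempty and has no element of maximal $\nu$-value. Let $\mathcal Q\subseteq\Psi_m$ be well-ordered by $Q<R\iff\nu(Q)<\nu(R)$ and cofinal in $\Psi_m$ for $\nu$-values; write $\gamma_Q=\nu(Q)$. As in the paper, all values $\nu_Q(f)$ ($f\ne0$) lie in $\Gamma$. ''For all $Q$ large enough'' means for all $Q$ in a final segment of $\mathcal Q$; a family indexed by $\mathcal Q$ is ultimately constant if it is constant on a final segment. $f$ is $\mathcal Q$-stable if $\nu_Q(f)=\nu(f)$ for all $Q$ large enough, $\mathcal Q$-unstable otherwise. Assume unstable polynomials exist; limit key polynomials are the monic $\mathcal Q$-unstable polynomials of minimal degree, forming $\mathrm{KP}_\infty(\mathcal Q)$. For each $f$, $\deg_Qf$ is ultimately constant; for $f\in\mathrm{KP}_\infty(\mathcal Q)$ its ultimate value $d$ (independent of $f$) is the defect of $\mathcal Q$. Fix $F\in\mathrm{KP}_\infty(\mathcal Q)$, $D=\lfloor\deg F/m\rfloor$, $F=\sum_{\ell=0}^DF_{Q,\ell}Q^\ell$, $\beta_{Q,\ell}=\nu(F_{Q,\ell})\in\Gamma\cup\{\infty\}$. Let $\delta^L$ be the smallest initial segment of $\Gamma$ containing $\{\nu_Q(F):Q\in\mathcal Q\}$; write $x>\delta^L$ if $x\in(\Gamma\setminus\delta^L)\cup\{\infty\}$. Let $J$ be the set of $\ell\in\{0,\dots,D\}$ with $\beta_{Q,\ell}+\ell\gamma_Q>\delta^L$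 for all $Q$ large enough, $B=\{0,\dots,D\}\setminus J$, and $B^{ct}$ the set of $\ell\in B$ for which $(\beta_{Q,\ell})_Q$ is ultimately constant. A cut $\eta=(\eta^L,\eta^R)$ of $\Gamma$ is vertically bounded if for every $x\in\eta^L$ and rational $q>1$ there is $y\in\eta^L$ with $q(y-x)>z-x$ for all $z\in\eta^L$; its invariance group is $\{h\in\Gamma:h+\eta^L=\eta^L\}$. Let $\gamma_{\mathcal Q}$ be the cut whose lower set is the smallest initial segment of $\Gamma$ containing $\{\gamma_Q\}$; $\mathcal Q$ is vertically unbounded if $\gamma_{\mathcal Q}$ is not vertically bounded; $H$ is the invariance group of $\gamma_{\mathcal Q}$. *)

(* Defs.v *)
From mathcomp Require Import all_boot all_order all_algebra.
Set Implicit Arguments. Unset Strict Implicit. Unset Printing Implicit Defensive.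
Import GRing.Theory.
Local Open Scope ring_scope.

(* A divisible ordered abelian group Lambda is modelled as a Q-vector  *)
(* space (L : lmodType rat; divisible torsion-free abelian groups are  *)
(* exactly Q-vector spaces) together with a translation-invariant     *)
(* total order leL.                                                    *)
Record oag_axioms (L : lmodType rat) (leL : rel L) : Prop := {
  oag_refl : reflexive leL;
  oag_trans : transitive leL;
  oag_anti : antisymmetric leL;
  oag_total : total leL;
  oag_add : forall x y z, leL x y -> leL (x + z) (y + z) }.

Section Valuations.
Variables (L : lmodType rat) (leL : rel L).

Definition ltL (x y : L) : bool := leL x y && (x != y).

(* values in Lambda \cup {oo}; None stands for oo *)
Definition vle (a b : option L) : bool :=
  match a, b with
  | _, None => true
  | None, Some _ => false
  | Some x, Some y => leL x y
  end.
Definition vlt (a b : option L) : bool := vle a b && ~~ vle b a.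
Definition vadd (a b : option L) : option L :=
  match a, b with Some x, Some y => Some (x + y) | _, _ => None end.
Definition vmin (a b : option L) : option L := if vle a b then a else b.
Definition vmuln (a : option L) (n : nat) : option L := omap (fun x => x *+ n) a.

Variable K : fieldType.

Record is_Kval (v : K -> option L) : Prop := {
  kv_inf : forall a, v a = None <-> a = 0;
  kv_mul : forall a b, v (a * b) = vadd (v a) (v b);
  kv_add : forall a b, vle (vmin (v a) (v b)) (v (a + b)) }.

(* nu is a valuation on the ring K[x] (possibly with nonzero support) *)
Record is_polyval (nu : {poly K} -> option L) : Prop := {
  pv_mul : forall f g, nu (f * g) = vadd (nu f) (nu g);
  pv_add : forall f g, vle (vmin (nu f) (nu g)) (nu (f + g)) }.

Variables (v : K -> option L) (nu : {poly K} -> option L).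

(* Gamma = divisible hull of vK inside Lambda *)
Definition inGamma (x : L) : Prop :=
  exists n : nat, (0 < n)%N /\ exists a : K, v a = Some (x *+ n).

Definition support_trivial : Prop := forall f, nu f = None -> f = 0.
(* value group of nu = {nu f - nu g : nu f, nu g < oo}; torsion mod Gamma *)
Definition valgroup_torsion_mod_Gamma : Prop :=
  forall f g a b, nu f = Some a -> nu g = Some b ->
    exists n : nat, (0 < n)%N /\ inGamma ((a - b) *+ n).
(* residue field of nu algebraic over that of v: every residue class of
   f/g (nu g < oo, nu f >= nu g) is a root of a nonzero polynomial over the
   residue field of v, i.e. of some P = sum c_i y^i with all v(c_i) >= 0 and
   some v(c_i) = 0, such that nu(P(f/g)) > 0, i.e.
   nu(sum c_i f^i g^(n-i)) > n nu(g). *)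
Definition residue_field_algebraic : Prop :=
  forall f g a b, nu f = Some a -> nu g = Some b -> leL b a ->
    exists (n : nat) (c : 'I_n.+1 -> K),
      (forall i, vle (Some 0) (v (c i))) /\ (exists i, v (c i) = Some 0) /\
      vlt (Some (b *+ n))
          (nu (\sum_(i < n.+1) (c i)%:P * f ^+ i * g ^+ (n - i))).
Definition well_specified : Prop :=
  ~ (support_trivial /\ valgroup_torsion_mod_Gamma /\ residue_field_algebraic).

Definition res_char_exp (p : nat) : Prop :=
  (prime p /\ vlt (Some 0) (v p%:R)) \/
  (p = 1%N /\ forall q, prime q -> ~~ vlt (Some 0) (v q%:R)).

Inductive lev := LMinf | LFin of L | LPinf.
Definition levle (a b : lev) : bool :=
  match a, b with
  | LMinf, _ => true
  | _, LPinf => true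
  | LFin x, LFin y => leL x y
  | _, _ => false
  end.
Definition levlt (a b : lev) : bool := levle a b && ~~ levle b a.
Definition levmax (a b : lev) : lev := if levle a b then b else a.

(* epsilon_nu(f) = max_{s >= 1} (nu f - nu(d_s f))/s, with d_s the s-th
   Hasse-Schmidt derivative f^`N(s); only s <= deg f contribute (for s > deg f,
   d_s f = 0 and the quotient is -oo).  Constants have level -oo.  Convention: nonconstant f with nu f = oo gets level +oo. *)
Definition level (f : {poly K}) : lev :=
  if (size f <= 1)%N then LMinf else
  match nu f with
  | None => LPinf
  | Some a =>
      foldr levmax LMinf
        [seq match nu (f^`N(s)) with
             | None => LMinf
             | Some b => LFin ((s%:R : rat)^-1 *: (a - b))
             end | s <- iota 1 (size f).-1]
  end.

Definition keypoly (Q : {poly K}) : Prop :=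
  Q \is monic /\ forall f : {poly K}, (size f < size Q)%N -> levlt (level f) (level Q).

Definition Psi (m : nat) (Q : {poly K}) : Prop := keypoly Q /\ (size Q).-1 = m.

(* Q-expansion: f = sum_i qcoef Q f i * Q^i with deg (qcoef Q f i) < deg Q *)
Definition qcoef (Q f : {poly K}) (i : nat) : {poly K} := (f %/ Q ^+ i) %% Q.
Definition nuQ (Q f : {poly K}) : option L :=
  foldr vmin None [seq nu (qcoef Q f i * Q ^+ i) | i <- iota 0 (size f)].
Definition degQ (Q f : {poly K}) : nat :=
  \max_(i < size f | nu (qcoef Q f i * Q ^+ i) == nuQ Q f) i.

Variable Qs : {poly K} -> Prop.

Definition family_well_ordered : Prop :=
  (forall Q R, Qs Q -> Qs R -> nu Q = nu R -> Q = R) /\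
  (forall S : {poly K} -> Prop, (forall Q, S Q -> Qs Q) -> (exists Q, S Q) ->
     exists Q, S Q /\ forall R, S R -> vle (nu Q) (nu R)).

Definition eventually (P : {poly K} -> Prop) : Prop :=
  exists Q0, Qs Q0 /\ forall Q, Qs Q -> vle (nu Q0) (nu Q) -> P Q.
Definition ult_const (b : {poly K} -> option L) : Prop :=
  exists Q0, Qs Q0 /\ forall Q, Qs Q -> vle (nu Q0) (nu Q) -> b Q = b Q0.

Definition stable (f : {poly K}) : Prop := eventually (fun Q => nuQ Q f = nu f).
Definition KPinf (F : {poly K}) : Prop :=
  F \is monic /\ ~ stable F /\ (forall g : {poly K}, ~ stable g -> (size F <= size g)%N).

Definition inDeltaL (F : {poly K}) (x : L) : Prop :=
  inGamma x /\ exists Q, Qs Q /\ vle (Some x) (nuQ Q F).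
Definition above_deltaL (F : {poly K}) (a : option L) : Prop :=
  match a with None => True | Some x => inGamma x /\ ~ inDeltaL F x end.
Definition Dnum (m : nat) (F : {poly K}) : nat := ((size F).-1 %/ m)%N.
Definition inJ (m : nat) (F : {poly K}) (l : nat) : Prop :=
  (l <= Dnum m F)%N /\
  eventually (fun Q => above_deltaL F (vadd (nu (qcoef Q F l)) (vmuln (nu Q) l))).
Definition inB (m : nat) (F : {poly K}) (l : nat) : Prop :=
  (l <= Dnum m F)%N /\ ~ inJ m F l.
Definition inBct (m : nat) (F : {poly K}) (l : nat) : Prop :=
  inB m F l /\ ult_const (fun Q => nu (qcoef Q F l)).

Definition cutQ_L (x : L) : Prop := inGamma x /\ exists Q, Qs Q /\ vle (Some x) (nu Q).
Definition vertically_bounded (Ls : L -> Prop) : Prop :=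
  forall x, Ls x -> forall q : rat, 1 < q ->
    exists y, Ls y /\ forall z, Ls z -> ltL (z - x) (q *: (y - x)).
Definition invariance_group (Ls : L -> Prop) (h : L) : Prop :=
  inGamma h /\ forall z, Ls z <-> exists x, Ls x /\ z = h + x.

End Valuations.

(* Main.v *)
(** The key polynomials of degree one are the [X - a], with increasing values
    [gam a] along the family; the expansion of [f] in [X - a] is its Taylor
    expansion at [a].  All [f] of degree less than [deg F], in particular the Hasse
    derivatives [F_l] with [l >= 1], are stable, so [v (F_l a)] is eventually a
    constant [beta l], finite because [v p] is finite.

    Vertical unboundedness means that the cut of the [gam a] is [x0 + H^+] for a
    convex subgroup [H].  Stability of [F_i] gives
    [beta i <= v 'C(j, i) + beta j + (j - i) gam a] for [i <= j], and the values of
    positive integers lie in [H], so [beta l + l x0] is nondecreasing in [l] modulo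
    [H].  Hence the linear Taylor term eventually dominates, and
    [v (F a) = beta 1 + gam a], since otherwise [F] would be stable: this is [d = 1].

    If [beta l + l x0 > beta 1 + x0] modulo [H], the truncation of the Taylor
    expansion of [F] below [l] takes the same values as [F] at all late [a], so it is
    unstable of degree less than [deg F], a contradiction.  So all [beta l + l x0]
    with [l >= 1] agree modulo [H], that is, [l] lies in [B]. *)
Require Import Defs.
From mathcomp Require Import all_boot all_order all_algebra.
From mathcomp Require Import zify lra.
From Stdlib Require Import Classical.
Set Implicit Arguments. Unset Strict Implicit. Unset Printing Implicit Defensive.
Import Order.TTheory GRing.Theory Num.Theory.
Local Open Scope ring_scope.

(** * Hasse derivatives and Taylor expansion *)

Lemma bin_trinomial i j k :
  ('C(i + (j + k), i) * 'C(j + k, j) = 'C(i + j + k, i + j) * 'C(i + j, i))%N.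
Proof.
(* Multiplied by i! j! k!, both sides become (i + j + k)!. *)
have f_gt0 : (0 < i`! * (j`! * k`!))%N by rewrite !muln_gt0 !fact_gt0.
apply/eqP; rewrite -(eqn_pmul2r f_gt0); apply/eqP.
have E1 := @bin_fact (i + (j + k)) i (leq_addr _ _).
have E2 := @bin_fact (j + k) j (leq_addr _ _).
have E3 := @bin_fact (i + j + k) (i + j) (leq_addr _ _).
have E4 := @bin_fact (i + j) i (leq_addr _ _).
rewrite addKn in E1; rewrite addKn in E2; rewrite addKn in E3.
rewrite addKn in E4.
transitivity (i + j + k)`!.
  by rewrite -addnA -E1 -E2; lia.
by rewrite -E3 -E4; lia.
Qed.

Lemma nderivn_nderivn (R : comNzRingType) (p : {poly R}) i j :
  p^`N(i)^`N(j) = p^`N(i + j) *+ 'C(i + j, i).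
Proof.
apply/polyP=> k; rewrite coefMn !coef_nderivn -!mulrnA -addnA.
by rewrite bin_trinomial addnA.
Qed.

Lemma poly_taylor (R : comNzRingType) (p : {poly R}) (a : R) :
  p = \sum_(i < size p) (p^`N(i).[a])%:P * ('X - a%:P) ^+ i.
Proof.
rewrite -{1}[p]comp_polyXr /comp_poly -[X in _.[X]](subrK a%:P) addrC.
rewrite (nderiv_taylor_wide (n := size p)) ?size_map_polyC //; last first.
  exact: mulrC.
by apply: eq_bigr => i _; rewrite nderivn_map horner_map.
Qed.

Lemma size_sum_XsubC (R : idomainType) (c : nat -> R) (a : R) n :
  (size (\sum_(j < n) (c j)%:P * ('X - a%:P) ^+ j)%R <= n)%N.
Proof.
apply: leq_trans (size_sum _ _ _) _; apply/bigmax_leqP => -[j jn] _ /=.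
apply: leq_trans (size_polyMleq _ _) _; rewrite size_exp_XsubC.
by have := size_polyC_leq1 (c j); lia.
Qed.

Lemma qcoef_XsubC (K : fieldType) (a : K) (f : {poly K}) i :
  qcoef ('X - a%:P) f i = (f^`N(i).[a])%:P.
Proof.
rewrite /qcoef; set q := 'X - a%:P.
pose c j := (f^`N(j).[a])%:P.
(* The Taylor sum is padded with zero terms so that it can be cut at any index [i], even beyond
   [size f]. The part from [i] on gives the quotient by [q ^+ i], and reduction modulo [q] keeps its
   constant term. *)
have Ef : f = \sum_(0 <= j < size f + i.+1) c j * q ^+ j.
  rewrite (big_cat_nat (n := size f)) ?leq_addr //= big_mkord -poly_taylor.
  rewrite big_nat_cond big1 ?addr0 // => j /andP[/andP[ij _] _].
  by rewrite /c nderivn_poly0 // horner0 mul0r.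
have Eq : f = (\sum_(0 <= j < size f + 1) c (j + i)%N * q ^+ j) * q ^+ i
              + \sum_(0 <= j < i) c j * q ^+ j.
  rewrite {1}Ef (big_cat_nat (n := i)) ?leq0n //=; last by lia.
  rewrite addrC; congr (_ + _); rewrite mulr_suml -{1}[i]add0n big_addn.
  have -> : (size f + i.+1 - i = size f + 1)%N by lia.
  by apply: eq_bigr => j _; rewrite -mulrA -exprD.
rewrite -(divpP Eq); last first.
  by rewrite size_exp_XsubC ltnS big_mkord (size_sum_XsubC (fun j => f^`N(j).[a])).
rewrite modp_XsubC; congr (_%:P); rewrite horner_sum addn1.
rewrite big_nat_recl // big1 => [|j _]; last first.
  by rewrite hornerM horner_exp !hornerE subrr exprS mul0r mulr0.
by rewrite expr0 mulr1 /c add0n hornerC addr0.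
Qed.

(** * The ordered group and its extension by infinity *)

Section LinearKeyPolynomials.
Variables (L : lmodType rat) (leL : rel L).
Hypothesis OAG : oag_axioms leL.

Lemma leL_add a b c d : leL a b -> leL c d -> leL (a + c) (b + d).
Proof.
move=> ab cd; apply: (oag_trans OAG (oag_add OAG c ab)).
by rewrite ![b + _]addrC; apply: oag_add.
Qed.

Lemma leL_add2r z x y : leL (x + z) (y + z) = leL x y.
Proof.
apply/idP/idP; last exact: oag_add.
by move=> /(oag_add OAG (- z)); rewrite !addrK.
Qed.

Lemma leL_add2l z x y : leL (z + x) (z + y) = leL x y.
Proof. by rewrite ![z + _]addrC leL_add2r. Qed.

Lemma leL_muln n x y : leL x y -> leL (x *+ n) (y *+ n).
Proof.
by move=> xy; elim: n => [|n IH]; [apply: (oag_refl OAG) | rewrite !mulrS leL_add].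
Qed.

Lemma nleL_le x y : ~~ leL x y -> leL y x.
Proof. by move=> /negPf xy; have := oag_total OAG x y; rewrite xy. Qed.

(** Multiplying [q *: x] by the denominator of [q] gives a natural multiple of [x], which is
    nonnegative. If [q *: x] is also at most 0, this multiple vanishes, hence so does [q *: x]. *)
Lemma leL_scale (q : rat) x : 0 <= q -> leL 0 x -> leL 0 (q *: x).
Proof.
move=> q0 x0; case/boolP: (leL 0 (q *: x)) => // nq.
have le0 := nleL_le nq.
have d0 : (0 < `|denq q|)%N by rewrite absz_gt0 denq_neq0.
have E : (q *: x) *+ `|denq q| = x *+ `|numq q|.
  rewrite -!scaler_nat scalerA; congr (_ *: _).
  rewrite !pmulrn !gez0_abs ?denq_ge0 ?numq_ge0 // mulrC.
  by rewrite numqE.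
have := oag_anti OAG (x := (q *: x) *+ `|denq q|) (y := 0).
rewrite {2}E -{1}(mul0rn _ `|denq q|) leL_muln //= -{1}(mul0rn _ `|numq q|).
rewrite leL_muln // => /(_ isT) /eqP.
rewrite -scaler_nat scaler_eq0 pnatr_eq0 -[_ == 0%N]negbK -lt0n d0 /=.
by move=> /eqP E0; rewrite E0 (oag_refl OAG) in nq.
Qed.

Local Notation le := (vle leL).

Lemma vle_refl a : le a a.
Proof. by case: a => [x|] //=; apply: (oag_refl OAG). Qed.

Lemma vle_trans b a c : le a b -> le b c -> le a c.
Proof. by case: a b c => [x|] [y|] [z|] //=; apply: (oag_trans OAG). Qed.

Lemma vle_anti a b : le a b -> le b a -> a = b.
Proof.
case: a b => [x|] [y|] //= xy yx; congr Some.
by apply: (oag_anti OAG); rewrite xy.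
Qed.

Lemma nvle_le a b : ~~ le a b -> le b a.
Proof. by case: a b => [x|] [y|] //=; apply: nleL_le. Qed.

Lemma vltE a b : vlt leL a b = ~~ le b a.
Proof.
by rewrite /vlt; case: (boolP (le b a)) => [_|/nvle_le ->]; rewrite ?andbF.
Qed.

Lemma vlt_le_trans b a c : ~~ le b a -> le b c -> ~~ le c a.
Proof. by move=> ba bc; apply: contra ba; apply: vle_trans. Qed.

Lemma vadd0e (a : option L) : vadd (Some 0) a = a.
Proof. by case: a => [x|] //=; rewrite add0r. Qed.

Lemma vaddC (a b : option L) : vadd a b = vadd b a.
Proof. by case: a b => [x|] [y|] //=; rewrite addrC. Qed.

Lemma vaddA (a b c : option L) : vadd a (vadd b c) = vadd (vadd a b) c.
Proof. by case: a b c => [x|] [y|] [z|] //=; rewrite addrA. Qed.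

Lemma vle_add a b c d : le a b -> le c d -> le (vadd a c) (vadd b d).
Proof. by case: a b c d => [x|] [y|] [z|] [t|] //=; apply: leL_add. Qed.

Lemma foldr_vmin_le (T : eqType) (g : T -> option L) s x :
  x \in s -> le (foldr (vmin leL) None [seq g i | i <- s]) (g x).
Proof.
elim: s => //= y s IH; rewrite in_cons /vmin => /orP[/eqP <-|/IH xs].
  by case: ifP => [_|/negbT /nvle_le //]; apply: vle_refl.
by case: ifP => // h; apply: vle_trans h xs.
Qed.

Lemma foldr_vmin_ge (T : eqType) (g : T -> option L) s z :
  {in s, forall x, le z (g x)} ->
  le z (foldr (vmin leL) None [seq g i | i <- s]).
Proof.
elim: s => [_|y s IH H] /=; first by case: z.
rewrite /vmin; case: ifP => _; first by apply: H; rewrite mem_head.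
by apply: IH => x xs; apply: H; rewrite in_cons xs orbT.
Qed.

(** * Valuations of polynomials extending [v] *)

Variables (K : fieldType) (v : K -> option L) (nu : {poly K} -> option L).
Hypothesis vP : is_Kval leL v.
Hypothesis nuP : is_polyval leL nu.
Hypothesis nuC : forall a : K, nu a%:P = v a.

Lemma nu0 : nu 0 = None.
Proof. by rewrite nuC; apply/(kv_inf vP). Qed.

Lemma nuC_eq_None a : nu a%:P = None -> a = 0.
Proof. by rewrite nuC => /(kv_inf vP). Qed.

Lemma nu1 : nu 1 = Some 0.
Proof.
have := pv_mul nuP 1 1; rewrite mul1r.
case E: (nu 1) => [x|] /=; last first.
  by move: (nuC_eq_None E) => /eqP; rewrite oner_eq0.
by case=> /eqP; rewrite -{1}[x]addr0 => /eqP /addrI <-.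
Qed.

Lemma nuN f : nu (- f) = nu f.
Proof.
suff nuN1 : nu (- 1) = Some 0 by rewrite -mulN1r (pv_mul nuP) nuN1 vadd0e.
have := pv_mul nuP (- 1) (- 1); rewrite mulrNN mul1r nu1.
case: (nu (- 1)) => [x|] //= [] /esym /eqP; rewrite -mulr2n -scaler_nat.
by rewrite scaler_eq0 => /eqP ->.
Qed.

Lemma nu_exp f x n : nu f = Some x -> nu (f ^+ n) = Some (x *+ n).
Proof.
move=> E; elim: n => [|n IH]; first by rewrite expr0 nu1.
by rewrite exprS (pv_mul nuP) IH E /= mulrS.
Qed.

Lemma nu_exp_ge f x n : le (Some x) (nu f) -> le (Some (x *+ n)) (nu (f ^+ n)).
Proof.
move=> xf; elim: n => [|n IH]; first by rewrite expr0 nu1; apply: vle_refl.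
by rewrite exprS (pv_mul nuP) mulrS; apply: (vle_add xf IH).
Qed.

(** An arbitrary upward closed set [U] of values treats weak and strict lower bounds at once. *)
Lemma nu_add_ind (U : option L -> Prop) f g :
  (forall a b, U a -> le a b -> U b) -> U (nu f) -> U (nu g) -> U (nu (f + g)).
Proof.
move=> Uup Uf Ug; apply: Uup (pv_add nuP f g).
by rewrite /vmin; case: ifP.
Qed.

Lemma nu_sum_ind (U : option L -> Prop) (I : Type) (r : seq I) (P : pred I)
  (f : I -> {poly K}) :
  (forall a b, U a -> le a b -> U b) -> U None ->
  (forall i, P i -> U (nu (f i))) -> U (nu (\sum_(i <- r | P i) f i)).
Proof.
move=> Uup U0 Uf; apply: (big_ind (fun g => U (nu g))) => //.
  by rewrite nu0.
by move=> g h; apply: nu_add_ind.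
Qed.

Lemma nu_sum_ge z (I : Type) (r : seq I) (P : pred I) (f : I -> {poly K}) :
  (forall i, P i -> le z (nu (f i))) -> le z (nu (\sum_(i <- r | P i) f i)).
Proof.
apply: (nu_sum_ind (U := fun a => le z a)) => [a b|]; last by case: (z).
exact: vle_trans.
Qed.

Lemma nu_sum_gt z (I : Type) (r : seq I) (P : pred I) (f : I -> {poly K}) :
  (forall i, P i -> ~~ le (nu (f i)) (Some z)) ->
  ~~ le (nu (\sum_(i <- r | P i) f i)) (Some z).
Proof.
apply: (nu_sum_ind (U := fun a => ~~ le a (Some z))) => // a b.
exact: vlt_le_trans.
Qed.

Lemma nu_add_lt f g : ~~ le (nu g) (nu f) -> nu (f + g) = nu f.
Proof.
move=> gf; have fg := nvle_le gf.
have ge : le (nu f) (nu (f + g)).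
  apply: (nu_add_ind (U := fun a => le (nu f) a)) => // [a b|].
    exact: vle_trans.
  exact: vle_refl.
(* If [f + g] had larger value than [f], then so would [f], as the difference of [f + g] and [g]. *)
apply: vle_anti => //; apply: contraT => lt.
have : ~~ le (nu ((f + g) - g)) (nu f).
  apply: (nu_add_ind (U := fun a => ~~ le a (nu f))) => //.
    by move=> a b; apply: vlt_le_trans.
  by rewrite nuN.
by rewrite addrK (vle_refl).
Qed.

Lemma nu_nat_ge0 n : le (Some 0) (nu n%:R).
Proof.
elim: n => [|n IH]; first by rewrite nu0.
rewrite -addn1 natrD; apply: (nu_add_ind (U := fun a => le (Some 0) a)) => //.
  by move=> a b; apply: vle_trans.
by rewrite nu1; apply: vle_refl.
Qed.

(** * Expansions in linear polynomials and stability *)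

Variables (Qs : {poly K} -> Prop) (gam : K -> L).
Hypothesis nuX : forall a, nu ('X - a%:P) = Some (gam a).
Hypothesis gam_nomax : forall a, exists b, ~~ leL (gam b) (gam a).
Hypothesis Qs_XsubC : forall Q, Qs Q -> exists a, Q = 'X - a%:P.
Hypothesis Qs_cofinal :
  forall a, exists b, Qs ('X - b%:P) /\ leL (gam a) (gam b).

Definition taylor_val a (f : {poly K}) i : option L :=
  vadd (nu (f^`N(i).[a])%:P) (Some (gam a *+ i)).

Local Notation nuXQ a f := (nuQ leL nu ('X - a%:P) f).

Lemma nu_qcoef_term a f i :
  nu (qcoef ('X - a%:P) f i * ('X - a%:P) ^+ i) = taylor_val a f i.
Proof.
by rewrite qcoef_XsubC (pv_mul nuP) (nu_exp _ (nuX a)).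
Qed.

Lemma taylor_val_big a (f : {poly K}) i :
  (size f <= i)%N -> taylor_val a f i = None.
Proof. by move=> fi; rewrite /taylor_val nderivn_poly0 // horner0 nu0. Qed.

Lemma nuXQ_le_term a f i : le (nuXQ a f) (taylor_val a f i).
Proof.
case: (ltnP i (size f)) => [fi|/taylor_val_big ->]; last by case: (nuXQ a f).
rewrite -nu_qcoef_term /nuQ.
by apply: (foldr_vmin_le (fun i => _)); rewrite mem_iota.
Qed.

Lemma nuXQ_ge a f z : (forall i, le z (taylor_val a f i)) -> le z (nuXQ a f).
Proof.
by move=> H; apply: foldr_vmin_ge => i _; rewrite nu_qcoef_term.
Qed.

Lemma nuXQ_le_nu a f : le (nuXQ a f) (nu f).
Proof.
rewrite {2}[f](poly_taylor f a); apply: nu_sum_ge => i _.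
rewrite -qcoef_XsubC nu_qcoef_term; exact: nuXQ_le_term.
Qed.

Lemma polyC_sub_XsubC a b : (b - a)%:P = ('X - a%:P) + - ('X - b%:P) :> {poly K}.
Proof. by rewrite polyCB opprB [RHS]addrC addrA subrK. Qed.

Lemma nu_subC_ge a b : leL (gam a) (gam b) -> le (Some (gam a)) (nu (b - a)%:P).
Proof.
move=> ab; rewrite polyC_sub_XsubC.
apply: (nu_add_ind (U := fun x => le (Some (gam a)) x)) => [x y||].
- exact: vle_trans.
- by rewrite nuX; apply: vle_refl.
- by rewrite nuN nuX.
Qed.

Lemma nu_subC_eq a b : ~~ leL (gam b) (gam a) -> nu (b - a)%:P = Some (gam a).
Proof.
move=> ab; rewrite polyC_sub_XsubC.
by rewrite nu_add_lt ?nuN !nuX.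
Qed.

Lemma horner_recenter (f : {poly K}) a b j :
  f^`N(j).[b] =
  \sum_(i < size (f^`N(j))) (f^`N(j + i).[a] *+ 'C(j + i, j)) * (b - a) ^+ i.
Proof.
rewrite -{1}[b](subrKC a) (nderiv_taylor _ (mulrC _ _)).
by apply: eq_bigr => i _; rewrite nderivn_nderivn hornerMn.
Qed.

(** Each coefficient at [b] is a combination of those at [a], with binomials of value at least 0 and
    powers of [b - a], whose value is at least [gam a]. The bound keeps the weight [gam a] rather
    than [gam b]; the gap between the two makes [stable_eval] work. *)
Lemma taylor_val_recenter z a b f j :
  (forall i, le z (taylor_val a f i)) -> leL (gam a) (gam b) ->
  le z (vadd (nu (f^`N(j).[b])%:P) (Some (gam a *+ j))).
Proof.
move=> zf ab; rewrite -(nu_exp _ (nuX a)) -(pv_mul nuP).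
rewrite (horner_recenter f a b) rmorph_sum mulr_suml.
apply: nu_sum_ge => i _ /=.
rewrite -mulr_natr !polyCM polyC_natr polyC_exp !(pv_mul nuP).
rewrite (nu_exp _ (nuX a)).
apply: (vle_trans (zf (j + i)%N)); rewrite /taylor_val.
have -> : Some (gam a *+ (j + i)) =
    vadd (Some 0) (vadd (Some (gam a *+ i)) (Some (gam a *+ j))).
  by rewrite vadd0e /= -mulrnDr addnC.
rewrite -!vaddA; do 3?[apply: vle_add]; [exact: vle_refl|..|exact: vle_refl].
  exact: nu_nat_ge0.
exact: (nu_exp_ge _ (nu_subC_ge ab)).
Qed.

Lemma nuXQ_mono a b f : leL (gam a) (gam b) -> le (nuXQ a f) (nuXQ b f).
Proof.
move=> ab; apply: nuXQ_ge => j; rewrite /taylor_val.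
apply: (vle_trans (taylor_val_recenter j (nuXQ_le_term a f) ab)).
apply: vle_add; first exact: vle_refl.
exact: leL_muln.
Qed.

Lemma nuXQ_const a b f :
  leL (gam a) (gam b) -> nuXQ a f = nu f -> nuXQ b f = nu f.
Proof.
move=> ab E; apply: vle_anti; first exact: nuXQ_le_nu.
by rewrite -E nuXQ_mono.
Qed.

Lemma eventually_XsubC (P : {poly K} -> Prop) a0 :
  (forall a, Qs ('X - a%:P) -> leL (gam a0) (gam a) -> P ('X - a%:P)) ->
  eventually leL nu Qs P.
Proof.
move=> H; have [b [Qb ab]] := Qs_cofinal a0.
exists ('X - b%:P); split=> // Q QQ; have [c Ec] := Qs_XsubC QQ.
rewrite Ec !nuX /= => bc; apply: H; first by rewrite -Ec.
exact: (oag_trans OAG) ab bc.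
Qed.

(** By monotonicity in the centre, one equality at any [a] in [K] propagates to a final segment of
    the family. *)
Lemma stableP f : stable leL nu Qs f <-> exists a, nuXQ a f = nu f.
Proof.
split=> [[Q [QQ H]]|[a E]].
  have [a Ea] := Qs_XsubC QQ; exists a; rewrite -Ea; apply: H => //.
  exact: vle_refl.
by apply: (@eventually_XsubC _ a) => b _ ab; apply: nuXQ_const E.
Qed.

Lemma taylor_head a (f : {poly K}) : exists2 g,
  f = (f.[a])%:P + g &
  forall z, (forall i, ~~ le (taylor_val a f i.+1) (Some z)) ->
            ~~ le (nu g) (Some z).
Proof.
case E : (size f) => [|n].
  move/eqP: E; rewrite size_poly_eq0 => /eqP ->; exists 0.
    by rewrite horner0 addr0.
  by rewrite nu0.
exists (\sum_(i < n) (f^`N(i.+1).[a])%:P * ('X - a%:P) ^+ i.+1).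
  rewrite {1}(poly_taylor f a) E big_ord_recl /= nderivn0 expr0 mulr1.
  by congr (_ + _); apply: eq_bigr => i _.
move=> z H; apply: nu_sum_gt => i _.
by rewrite -qcoef_XsubC nu_qcoef_term.
Qed.

(** At a later centre [b] the Taylor term of index i >= 1 exceeds [nu f] by at least i (gam b - gam
    a), so the constant term alone carries the value. *)
Lemma stable_eval f a b :
  nuXQ a f = nu f -> ~~ leL (gam b) (gam a) -> nu (f.[b])%:P = nu f.
Proof.
move=> E ab; have leab := nleL_le ab.
have Eb := nuXQ_const leab E.
case Ef : (nu f) => [w|]; last first.
  have := nuXQ_le_term b f 0; rewrite Eb Ef /taylor_val nderivn0.
  by case: (nu _).
have [g Eg Hg] := taylor_head b f.
have gw : ~~ le (nu g) (Some w).
  apply: Hg => i; have := taylor_val_recenter i.+1 (nuXQ_le_term a f) leab.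
  rewrite E Ef /taylor_val; case: (nu _) => [x|] //= wx.
  apply: contra ab => h; have {}h := oag_trans OAG h wx.
  rewrite leL_add2l !mulrS in h.
  have := leL_add h (leL_muln i leab).
  by rewrite [X in leL _ X]addrAC !leL_add2r.
by rewrite -Ef -[f.[b]%:P](addrK g) -Eg nu_add_lt //
  nuN Ef.
Qed.

(** A strictly dominant constant term determines both [nu f] and the truncated value. Used in
    contrapositive form to bound [nu (F.[a])%:P] from below for unstable [F]. *)
Lemma eval_lt_stable f a :
  (forall i, ~~ le (taylor_val a f i.+1) (nu (f.[a])%:P)) -> stable leL nu Qs f.
Proof.
move=> H; apply/stableP; exists a.
have [g Eg Hg] := taylor_head a f.
case E : (nu (f.[a])%:P) => [w|]; last first.
  by have := H 0%N; rewrite E; case: (taylor_val _ _ _).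
have Ef : nu f = Some w.
  rewrite Eg nu_add_lt // E; apply: Hg => i.
  by rewrite -E.
apply: vle_anti; first exact: nuXQ_le_nu.
apply: nuXQ_ge => -[|i]; rewrite Ef -E.
  by rewrite /taylor_val nderivn0 mulr0n vaddC vadd0e; apply: vle_refl.
exact: nvle_le.
Qed.

Lemma gam_max a b : exists2 c, leL (gam a) (gam c) & leL (gam b) (gam c).
Proof.
case/boolP: (leL (gam a) (gam b)) => [ab|/nleL_le ba].
  by exists b => //; apply: (oag_refl OAG).
by exists a => //; apply: (oag_refl OAG).
Qed.

Lemma eventually_all n (P : nat -> K -> Prop) :
  (forall l, (l < n)%N -> exists a0, forall a, leL (gam a0) (gam a) -> P l a) ->
  exists a0, forall a, leL (gam a0) (gam a) -> forall l, (l < n)%N -> P l a.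
Proof.
elim: n => [|n IH] H; first by exists 0.
have [a0 H0] := IH (fun l ln => H l (ltnW ln)).
have [a1 H1] := H n (ltnSn n).
have [a2 le0 le1] := gam_max a0 a1; exists a2 => a le2 l.
rewrite ltnS leq_eqVlt => /orP[/eqP ->|ln].
  by apply: H1; apply: (oag_trans OAG) le2.
by apply: H0 ln; apply: (oag_trans OAG) le2.
Qed.

(** * The cut and comparison modulo its convex subgroup *)

Definition in_shifted_cut x0 t := exists b, leL (x0 + t) (gam b).

(* Iterating dilation by [q > 1] yields dilation by [2], so the positive part of
   the cut shifted to [x0] is the positive cone of a convex subgroup. *)
Lemma in_shifted_cutD (q : rat) x0 :
  1 < q -> (forall b, exists c, leL (q *: (gam b - x0)) (gam c - x0)) ->
  in_shifted_cut x0 0 ->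
  forall s t, in_shifted_cut x0 s -> in_shifted_cut x0 t ->
  in_shifted_cut x0 (s + t).
Proof.
move=> q1 qP C0; have q0 : 0 <= q by apply: le_trans (ltW q1); rewrite ler01.
have Cle s t : leL s t -> in_shifted_cut x0 t -> in_shifted_cut x0 s.
  move=> st [b tb]; exists b; apply: (oag_trans OAG) tb.
  by rewrite leL_add2l.
have Cq t : in_shifted_cut x0 t -> in_shifted_cut x0 (q *: t).
  move=> [b tb]; have [c bc] := qP b; exists c.
  rewrite -(leL_add2l x0) subrKC in bc; apply: (oag_trans OAG) bc.
  rewrite leL_add2l -(leL_add2r (- (q *: t))) subrr -scalerBr.
  apply: leL_scale => //; rewrite -(leL_add2r (x0 + t)) add0r.
  by rewrite -[_ - x0 - t]addrA -opprD subrK.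
have CqX k t : in_shifted_cut x0 t -> in_shifted_cut x0 (q ^+ k *: t).
  move=> Ct; elim: k => [|k IH]; first by rewrite expr0 scale1r.
  by rewrite exprS -scalerA; apply: Cq.
have [k k2] : exists k, 2 <= q ^+ k.
  (* Bernoulli's inequality; any k >= 1 / (q - 1) then gives a power at least 2. *)
  have bern k : 1 + (q - 1) * k%:R <= q ^+ k.
    elim: k => [|k IH]; first by rewrite mulr0 addr0.
    have : 0 <= (q - 1) * (q - 1) * k%:R.
      by rewrite !mulr_ge0 ?ler0n // subr_ge0 ltW.
    have := ler_wpM2l q0 IH; rewrite -exprS -natr1; nra.
  have := archi_boundP (x := (q - 1)^-1); rewrite invr_ge0 subr_ge0 (ltW q1).
  move=> /(_ isT); set N := Num.bound _ => hN; exists N.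
  apply: le_trans (bern N); have q10 : 0 < q - 1 by rewrite subr_gt0.
  by rewrite lerD2l -ler_pdivrMl // mulr1 ltW.
have C2 t : leL 0 t -> in_shifted_cut x0 t -> in_shifted_cut x0 (t + t).
  move=> t0 /(CqX k); apply: Cle; rewrite -mulr2n -scaler_nat.
  rewrite -(leL_add2r (- (2 *: t))) subrr -scalerBl.
  by apply: leL_scale; rewrite ?subr_ge0.
have Cmax s t : in_shifted_cut x0 s -> in_shifted_cut x0 t ->
    exists u, [/\ in_shifted_cut x0 u, leL s u & leL t u].
  move=> Cs Ct; case/boolP: (leL s t) => [st|/nleL_le ts].
    by exists t; split=> //; apply: (oag_refl OAG).
  by exists s; split=> //; apply: (oag_refl OAG).
(* Both [s] and [t] are below a common nonnegative [w] of the shifted cut, so [s + t] is below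
   [w + w]. *)
move=> s t Cs Ct; have [u [Cu su tu]] := Cmax s t Cs Ct.
have [w [Cw w0 uw]] := Cmax 0 u C0 Cu.
apply: Cle (C2 w w0 Cw).
by apply: leL_add; [apply: (oag_trans OAG) su uw | apply: (oag_trans OAG) tu uw].
Qed.

Variable x0 : L.
Local Notation in_cut := (in_shifted_cut x0).
Hypothesis cut0 : in_cut 0.
Hypothesis cutD :
  forall s t, in_cut s -> in_cut t -> in_cut (s + t).

(* When the cut [x0 + H^+] is generated by a convex subgroup [H], this is the
   preorder on [L] induced by the order of [L / H]. *)
Definition cut_le x y := exists2 s, in_cut s & leL x (y + s).

Lemma in_shifted_cut_muln n t : in_cut t -> in_cut (t *+ n).
Proof.
by move=> ct; elim: n => [|n IH]; rewrite ?mulr0n // mulrS; apply: cutD.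
Qed.

Lemma leL_cut_le x y : leL x y -> cut_le x y.
Proof. by exists 0; rewrite ?addr0. Qed.

Lemma cut_le_trans y x z : cut_le x y -> cut_le y z -> cut_le x z.
Proof.
move=> [s cs xy] [t ct yz]; exists (t + s); first exact: cutD.
by apply: (oag_trans OAG) xy _; rewrite addrA leL_add2r.
Qed.

Lemma cut_le_add x y z t : cut_le x y -> cut_le z t -> cut_le (x + z) (y + t).
Proof.
move=> [r cr xy] [s cs zt]; exists (r + s); first exact: cutD.
by rewrite addrACA; apply: leL_add.
Qed.

Lemma cut_le_refl x : cut_le x x.
Proof. by apply: leL_cut_le; apply: (oag_refl OAG). Qed.

Lemma cut_le_gam a n : cut_le (gam a *+ n) (x0 *+ n).
Proof.
exists ((gam a - x0) *+ n); last first.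
  by rewrite -mulrnDl subrKC; apply: (oag_refl OAG).
by apply: in_shifted_cut_muln; exists a; rewrite subrKC; apply: (oag_refl OAG).
Qed.

(** Strong induction, splitting off the smallest prime divisor: it has value 0 or is covered by the
    hypothesis. *)
Lemma nu_nat_in_cut :
  (forall p, prime p -> ~~ le (nu p%:R) (Some 0) ->
     exists2 h, nu p%:R = Some h & in_cut h) ->
  forall k, (0 < k)%N -> exists2 c, nu k%:R = Some c & in_cut c.
Proof.
move=> H; elim/ltn_ind => k IH k0.
have [k1|k1] := leqP k 1.
  by have -> : k = 1%N; [lia | exists 0; rewrite ?nu1].
have pk := pdiv_prime k1; have dk := pdiv_dvd k.
have [||c Ec Cc] := IH (k %/ pdiv k)%N.
- by rewrite ltn_Pdiv ?prime_gt1.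
- by rewrite divn_gt0 ?pdiv_gt0 // pdiv_leq.
have [h Eh Ch] : exists2 h, nu (pdiv k)%:R = Some h & in_cut h.
  case/boolP: (le (nu (pdiv k)%:R) (Some 0)) => [le0|/(H _ pk) //].
  by exists 0 => //; apply: vle_anti => //; apply: nu_nat_ge0.
exists (c + h); last exact: cutD.
by rewrite -[k in nu k%:R](divnK dk) natrM (pv_mul nuP) Ec Eh.
Qed.

(** * Taylor coefficients of a limit key polynomial *)

Hypothesis nu_nat_cut :
  forall k, (0 < k)%N -> exists2 c, nu k%:R = Some c & in_cut c.

Variable F : {poly K}.
Hypothesis F_monic : F \is monic.
Hypothesis F_unstable : ~ stable leL nu Qs F.
Hypothesis F_min :
  forall g : {poly K}, ~ stable leL nu Qs g -> (size F <= size g)%N.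

Lemma size_lt_stable (g : {poly K}) : (size g < size F)%N -> stable leL nu Qs g.
Proof. by move=> gF; apply: NNPP => /F_min; rewrite leqNgt gF. Qed.

Lemma size_limit_gt1 : (1 < size F)%N.
Proof.
rewrite ltnNge; apply/negP => F1; apply: F_unstable.
apply: (eval_lt_stable (a := 0)) => i.
rewrite taylor_val_big; last exact: leq_trans F1 _.
rewrite [in X in nu X](size1_polyC F1) hornerC -size1_polyC //.
case E : (nu F) => //; move: E; rewrite (size1_polyC F1) => /nuC_eq_None E.
by move: (monic_neq0 F_monic); rewrite (size1_polyC F1) E eqxx.
Qed.

Lemma size_nderivn_lt l : (0 < l)%N -> (size F^`N(l) < size F)%N.
Proof.
move=> l0; have := size_limit_gt1; case E : (size F) => [|n] // _.
rewrite ltnS; apply/leq_sizeP => j nj; rewrite coef_nderivn nth_default ?mul0rn //.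
by rewrite E; lia.
Qed.

Lemma nderivn_eventually : exists a0, forall a, leL (gam a0) (gam a) ->
  forall l, (0 < l)%N -> nuXQ a F^`N(l) = nu F^`N(l) /\
                         nu (F^`N(l).[a])%:P = nu F^`N(l).
Proof.
have [|a0 H] := @eventually_all (size F) (fun l a => (0 < l)%N ->
  nuXQ a F^`N(l) = nu F^`N(l) /\ nu (F^`N(l).[a])%:P = nu F^`N(l)).
  case=> [|l] lF; first by exists 0.
  have /stableP[a Ea] := size_lt_stable (size_nderivn_lt (ltn0Sn l)).
  have [b ab] := gam_nomax a; exists b => c bc _.
  have ac : ~~ leL (gam c) (gam a).
    by apply: contra ab => ca; apply: (oag_trans OAG) bc ca.
  by split; [apply: nuXQ_const (nleL_le ac) Ea | apply: stable_eval Ea ac].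
(* From index [size F] on the derivatives vanish and all values are infinite. *)
exists a0 => a le0 l l0; case: (ltnP l (size F)) => lF; first exact: H.
by rewrite nderivn_poly0 // horner0 nu0 /nuQ size_poly0.
Qed.

(** By [nu_nderivn], the default 0 is not reached for 0 < l < size F. *)
Definition beta l := odflt 0 (nu F^`N(l)).

(** Since [nu] may have nonzero support, an infinite value is excluded in two steps. By stability
    all Taylor coefficients of the derivative would be 0, hence the derivative itself; but its top
    coefficient is a binomial coefficient, of finite value because [F] is monic and positive
    integers have finite value. *)
Lemma nu_nderivn l : (0 < l < size F)%N -> nu F^`N(l) = Some (beta l).
Proof.
move=> /andP[l0 lF]; rewrite /beta; case E : (nu F^`N(l)) => [x|] //=.
have [a0 /(_ a0 (oag_refl OAG _) l l0)[Ea _]] := nderivn_eventually.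
have F0 : F^`N(l) = 0.
  rewrite (poly_taylor F^`N(l) a0) big1 // => i _.
  have := nuXQ_le_term a0 F^`N(l) i; rewrite Ea E /taylor_val.
  case E0 : (nu _) => [x|] // _.
  by rewrite (nuC_eq_None E0) mul0r.
have := coef_nderivn l F ((size F).-1 - l).
have -> : (l + ((size F).-1 - l) = (size F).-1)%N by lia.
have /monicP := F_monic; rewrite /lead_coef => ->; rewrite F0 coef0 => E1.
have [|c] := @nu_nat_cut 'C((size F).-1, l); first by rewrite bin_gt0; lia.
by rewrite -polyC_natr -E1 nu0.
Qed.

Lemma beta_cut_le i j : (0 < i)%N -> (i <= j)%N -> (j < size F)%N ->
  cut_le (beta i) (beta j + x0 *+ (j - i)).
Proof.
move=> i0 ij jF.
have [a H] := nderivn_eventually.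
have [Ei _] := H a (oag_refl OAG _) i i0.
have [_ Ej] := H a (oag_refl OAG _) j (leq_trans i0 ij).
have [|c Ec cutc] := @nu_nat_cut 'C(j, i); first by rewrite bin_gt0.
(* The term of index j - i in the expansion of the i-th derivative has coefficient 'C(j, i) times
   the j-th derivative of [F] at [a]. *)
have := nuXQ_le_term a F^`N(i) (j - i).
rewrite Ei /taylor_val nderivn_nderivn subnKC // hornerMn -mulr_natr polyCM.
rewrite polyC_natr (pv_mul nuP) Ec Ej !nu_nderivn ?jF ?i0 ?(leq_trans i0) //;
  last exact: leq_ltn_trans jF.
move=> /= le1; apply: cut_le_trans (leL_cut_le le1) _.
apply: cut_le_add; last exact: cut_le_gam.
rewrite -[X in cut_le _ X]addr0; apply: cut_le_add; first exact: cut_le_refl.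
by exists c; rewrite // add0r; apply: (oag_refl OAG).
Qed.

(** In the bound of [beta 1] by beta l + (l - 1) x0 + s, one copy of x0 absorbs s into a fixed
    [gam b] and the others are at most [gam a]. Once [gam a] exceeds [gam b], the term of index l is
    strictly larger than the linear one. *)
Lemma beta1_lt : exists a0, forall a, leL (gam a0) (gam a) ->
  forall l, (1 < l < size F)%N -> ~~ leL (beta l + gam a *+ l) (beta 1 + gam a).
Proof.
have [|a0 H] := @eventually_all (size F) (fun l a => (1 < l)%N ->
  ~~ leL (beta l + gam a *+ l) (beta 1 + gam a)); last first.
  by exists a0 => a le0 l /andP[l1 lF]; apply: H.
case=> [|[|k]] lF; [by exists 0|by exists 0|].
have [s [b sb] les] := beta_cut_le (isT : 0 < 1)%N (isT : 1 <= k.+2)%N lF.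
have [a1 ba1] := gam_nomax b; have [b0] := cut0; rewrite addr0 => xb0.
have [a2 a12 b02] := gam_max a1 b0.
exists a2 => a le2 _; apply: contra ba1 => h.
have xa : leL x0 (gam a).
  by apply: (oag_trans OAG) xb0 _; apply: (oag_trans OAG) b02 le2.
apply: (oag_trans OAG) a12 _; apply: (oag_trans OAG) le2 _.
rewrite subn1 /= in les.
have le1 : leL (beta k.+2 + x0 *+ k.+1 + s + gam a)
              (beta k.+2 + (gam a *+ k + gam b) + gam a).
  by rewrite leL_add2r -!addrA leL_add2l mulrSr -addrA leL_add ?leL_muln.
rewrite -(leL_add2r (gam a)) in les.
have := oag_trans OAG h (oag_trans OAG les le1).
by rewrite !mulrSr !addrA leL_add2r leL_add2l.
Qed.

Lemma taylor_val_eventually : exists a0, forall a, leL (gam a0) (gam a) ->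
  taylor_val a F 1 = Some (beta 1 + gam a) /\
  forall i, ~~ le (taylor_val a F i.+2) (Some (beta 1 + gam a)).
Proof.
have [a1 H1] := nderivn_eventually; have [a2 H2] := beta1_lt.
have [a0 le1 le2] := gam_max a1 a2.
exists a0 => a le0; split=> [|i].
  rewrite /taylor_val; have [_ ->] := H1 a (oag_trans OAG le1 le0) 1%N isT.
  by rewrite nu_nderivn ?size_limit_gt1.
case: (ltnP i.+2 (size F)) => [iF|/taylor_val_big -> //].
rewrite /taylor_val; have [_ ->] := H1 a (oag_trans OAG le1 le0) i.+2 isT.
by rewrite nu_nderivn //= H2 // (oag_trans OAG le2 le0).
Qed.

(** A smaller value would make [F] stable. If the value at [a] were larger, then in the expansion of
    [F.[b]] around [a], for a later [b], the linear term would strictly dominate, giving [F.[b]] the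
    value [beta 1 + gam a], below the lower bound [beta 1 + gam b]. *)
Lemma nu_eval_limit : exists a0, forall a, leL (gam a0) (gam a) ->
  nu (F.[a])%:P = Some (beta 1 + gam a).
Proof.
have [a0 H] := taylor_val_eventually.
have ge a : leL (gam a0) (gam a) -> le (Some (beta 1 + gam a)) (nu (F.[a])%:P).
  move=> /H[H1 H2]; apply: contraT => lt; case: F_unstable.
  apply: (eval_lt_stable (a := a)) => -[|i]; first by rewrite H1.
  by apply: vlt_le_trans lt _; apply: nvle_le.
exists a0 => a le0; apply: vle_anti; last exact: ge.
have [H1 H2] := H a le0.
apply: contraT => gt; have [b ab] := gam_nomax a.
have leab := nleL_le ab; have := ge b (oag_trans OAG le0 leab).
have EF := horner_recenter F a b 0; rewrite nderivn0 in EF.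
have := size_limit_gt1; case EsF : (size F) EF => [|[|n]] // EF _.
have E1 : nu (F^`N(1).[a] * (b - a))%:P = Some (beta 1 + gam a).
  by rewrite polyCM (pv_mul nuP) (nu_subC_eq ab) -H1 /taylor_val mulr1n.
rewrite EF !big_ord_recl /= addrCA polyCD expr1 bin0 mulr1n nu_add_lt E1.
  by rewrite /= leL_add2l (negPf ab).
rewrite expr0 mulr1 bin0 mulr1n nderivn0 polyCD.
apply: (nu_add_ind (U := fun x => ~~ le x (Some (beta 1 + gam a)))) => //.
  by move=> x y; apply: vlt_le_trans.
rewrite rmorph_sum; apply: nu_sum_gt => i _ /=.
apply: vlt_le_trans (H2 i) _.
rewrite /taylor_val polyCM (pv_mul nuP) bin0 mulr1n polyC_exp.
apply: vle_add; first exact: vle_refl.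
exact: (nu_exp_ge _ (nu_subC_ge leab)).
Qed.

Lemma beta_cut_ge l : (0 < l < size F)%N -> cut_le (beta l + x0 *+ l.-1) (beta 1).
Proof.
move=> /andP[l0 lF]; apply: NNPP => nl.
(* Failure at [l] propagates to every larger index, so the whole tail can be discarded. *)
have {}nl j : (l <= j < size F)%N -> ~ cut_le (beta j + x0 *+ j.-1) (beta 1).
  move=> /andP[lj jF] hj; apply: nl; apply: cut_le_trans hj.
  have -> : j.-1 = (j - l + l.-1)%N by lia.
  rewrite mulrnDr addrA; apply: cut_le_add; last exact: cut_le_refl.
  exact: beta_cut_le.
have [a1 H1] := nderivn_eventually; have [a2 H2] := nu_eval_limit.
have [b0] := cut0; rewrite addr0 => xb0.
have [a3 le13 le23] := gam_max a1 a2; have [a0 le3 leb] := gam_max a3 b0.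
(* The centre [a0] of the truncation is fixed while the evaluation point [a] moves. *)
pose G := \sum_(j < l) (F^`N(j).[a0])%:P * ('X - a0%:P) ^+ j.
have EG a : leL (gam a0) (gam a) -> nu (G.[a])%:P = Some (beta 1 + gam a).
  move=> le0; have EF := H2 a (oag_trans OAG le23 (oag_trans OAG le3 le0)).
  have := horner_recenter F a0 a 0; rewrite nderivn0 -(big_mkord xpredT
    (fun i => (F^`N(0 + i).[a0] *+ 'C(0 + i, 0)) * (a - a0) ^+ i)).
  rewrite (big_cat_nat (n := l)) ?(ltnW lF) //=; set E := (X in _ + X).
  have -> : \sum_(0 <= i < l) (F^`N(0 + i).[a0] *+ 'C(0 + i, 0)) * (a - a0) ^+ i
            = G.[a].
    rewrite /G horner_sum big_mkord; apply: eq_bigr => i _.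
    by rewrite bin0 mulr1n !hornerE.
  move=> EFG; rewrite -[G.[a]](addrK E) -EFG polyCB nu_add_lt // nuN EF.
  rewrite /E big_nat_cond rmorph_sum; apply: nu_sum_gt => i /=.
  rewrite andbT bin0 mulr1n add0n => /andP[li iF].
  have i0 : (0 < i)%N := leq_trans l0 li.
  have [_ Ei] := H1 a0 (oag_trans OAG le13 le3) i i0.
  rewrite polyCM (pv_mul nuP) Ei nu_nderivn ?i0 // polyC_exp.
  have ge1 := vle_add (vle_refl (Some (beta i))) (nu_exp_ge i (nu_subC_ge le0)).
  apply: vlt_le_trans ge1 => /=; apply/negP => h.
  apply: (nl i); first by rewrite li.
  (* A tail term of value at most [beta 1 + gam a] would give the excluded comparison, with gam a -
     x0 as the error: it lies in the shifted cut however late [a] is. *)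
  exists (gam a - x0); first by exists a; rewrite subrKC; apply: (oag_refl OAG).
  rewrite -(leL_add2r x0) -addrA -mulrSr prednK // addrA subrK.
  apply: (oag_trans OAG) h; rewrite leL_add2l leL_muln //.
  exact: (oag_trans OAG) xb0 leb.
have /stableP[a4 E4] : stable leL nu Qs G.
  apply: size_lt_stable; apply: leq_ltn_trans lF.
  exact: (size_sum_XsubC (fun j => F^`N(j).[a0])).
(* Stability makes the value of [G] the same at [a6] and [a7], whereas [EG] makes it strictly
   increase. *)
have [a5 le05 le45] := gam_max a0 a4.
have [a6 lt6] := gam_nomax a5; have [a7 lt7] := gam_nomax a6.
have le6 := nleL_le lt6; have le7 := nleL_le lt7.
have E6 : nu (G.[a6])%:P = nu G.
  apply: stable_eval E4 _; apply: contra lt6 => h; exact: (oag_trans OAG) h le45.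
have E7 : nu (G.[a7])%:P = nu G.
  apply: stable_eval E4 _; apply: contra lt7 => h.
  exact: (oag_trans OAG) h (oag_trans OAG le45 le6).
move: E7; rewrite -E6 !EG //; first last.
- exact: (oag_trans OAG) le05 (oag_trans OAG le6 le7).
- exact: (oag_trans OAG) le05 le6.
by case=> /addrI E; rewrite E (oag_refl OAG) in lt7.
Qed.

(** * The defect and the set B^ct *)

Lemma nuXQ_limit : exists a0, forall a, leL (gam a0) (gam a) ->
  nuXQ a F = Some (beta 1 + gam a).
Proof.
have [a1 H1] := taylor_val_eventually; have [a2 H2] := nu_eval_limit.
have [a0 le1 le2] := gam_max a1 a2; exists a0 => a le0.
have [E1 Egt] := H1 a (oag_trans OAG le1 le0).
apply: vle_anti; first by rewrite -E1; apply: nuXQ_le_term.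
apply: nuXQ_ge => -[|[|i]].
- rewrite /taylor_val nderivn0 mulr0n vaddC vadd0e H2; first exact: vle_refl.
  exact: (oag_trans OAG) le2 le0.
- by rewrite E1; apply: vle_refl.
- exact: nvle_le.
Qed.

(** Terms 0 and 1 both attain the minimum and all later terms exceed it. *)
Lemma degQ_limit : eventually leL nu Qs (fun Q => degQ leL nu Q F = 1%N).
Proof.
have [a1 H1] := taylor_val_eventually; have [a2 H2] := nuXQ_limit.
have [a0 le1 le2] := gam_max a1 a2.
apply: (@eventually_XsubC _ a0) => a _ le0.
have [E1 Egt] := H1 a (oag_trans OAG le1 le0).
have EQ := H2 a (oag_trans OAG le2 le0).
apply/eqP; rewrite eqn_leq; apply/andP; split.
  apply/bigmax_leqP => -[[|[|i]] iF] //= /eqP; rewrite nu_qcoef_term EQ => E.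
  by have := Egt i; rewrite E vle_refl.
apply: (leq_bigmax_cond (Ordinal size_limit_gt1)) => /=.
by rewrite nu_qcoef_term E1 EQ.
Qed.

(** The coefficient of index 0 has eventual value [beta 1 + gam a], which keeps increasing along the
    family. *)
Lemma ult_const_coef l : ult_const leL nu Qs (fun Q => nu (qcoef Q F l)) <-> (0 < l)%N.
Proof.
split=> [[Q0 [QQ0 H]]|l0]; last first.
  have [a1 H1] := nderivn_eventually; have [a0 [Qa0 le1]] := Qs_cofinal a1.
  exists ('X - a0%:P); split=> // Q QQ; have [a ->] := Qs_XsubC QQ.
  rewrite !nuX /= => le0; rewrite !qcoef_XsubC.
  have [_ ->] := H1 a (oag_trans OAG le1 le0) l l0.
  by have [_ ->] := H1 a0 le1 l l0.
case: l H => // H; have [a0 E0] := Qs_XsubC QQ0; rewrite {}E0 in QQ0 H.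
have E a : Qs ('X - a%:P) -> leL (gam a0) (gam a) ->
    nu (F.[a])%:P = nu (F.[a0])%:P.
  by move=> Qa le0; have := H _ Qa; rewrite !nuX !qcoef_XsubC nderivn0; apply.
have [a1 H1] := nu_eval_limit; have [b le0 le1] := gam_max a0 a1.
have [a2 [Qa2 le2]] := Qs_cofinal b.
have [a3 lt3] := gam_nomax a2; have [a4 [Qa4 le4]] := Qs_cofinal a3.
have le24 := oag_trans OAG (nleL_le lt3) le4.
have := E a4 Qa4 (oag_trans OAG le0 (oag_trans OAG le2 le24)).
rewrite -(E a2 Qa2 (oag_trans OAG le0 le2)) !H1; first last.
- exact: (oag_trans OAG) le1 (oag_trans OAG le2 le24).
- exact: (oag_trans OAG) le1 le2.
by case=> /addrI E4; rewrite -E4 le4 in lt3.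
Qed.

Lemma not_inJ l : (0 < l < size F)%N -> ~ inJ leL v nu Qs 1 F l.
Proof.
move=> /andP[l0 lF] [_ [Q0 [QQ0 H]]].
have [a0 E0] := Qs_XsubC QQ0; rewrite {}E0 in QQ0 H.
have [a1 H1] := nderivn_eventually; have [a2 H2] := nuXQ_limit.
have [b le0 le1] := gam_max a0 a1.
have [a [Qa leba]] := Qs_cofinal b.
have [_ Ea] := H1 a (oag_trans OAG le1 leba) l l0.
move: (H _ Qa); rewrite !nuX /= => /(_ (oag_trans OAG le0 leba)).
(* The assumption itself supplies [Ga], the membership in Gamma. It remains to bound the term by
   [beta 1 + gam d] for a late [d], which [beta_cut_ge] allows. *)
rewrite qcoef_XsubC Ea nu_nderivn ?l0 //= => -[Ga]; case.
split=> //.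
have [s [c sc] les] : cut_le (beta l + gam a *+ l) (beta 1 + x0).
  apply: cut_le_trans (cut_le_add (cut_le_refl (beta l)) (cut_le_gam a l)) _.
  rewrite -[in x0 *+ l](prednK l0) mulrSr addrA.
  apply: cut_le_add; last exact: cut_le_refl.
  by apply: beta_cut_ge; rewrite l0.
have [d1 led1 led2] := gam_max c a2; have [d [Qd led]] := Qs_cofinal d1.
exists ('X - d%:P); split=> //; rewrite H2; last exact: (oag_trans OAG) led2 led.
apply: (oag_trans OAG) les _; rewrite -addrA leL_add2l.
by apply: (oag_trans OAG) sc _; apply: (oag_trans OAG) led1 led.
Qed.

Lemma inBct_limit l : inBct leL v nu Qs 1 F l <-> (1 <= l <= Dnum 1 F)%N.
Proof.
have := size_limit_gt1; rewrite /inBct /inB /Dnum divn1 => F1.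
split=> [[[lD _] /ult_const_coef ->] //|/andP[l0 lD]].
split; last exact/ult_const_coef.
by split=> //; apply: not_inJ; rewrite l0; lia.
Qed.

End LinearKeyPolynomials.

(** * Key polynomials of degree one and the conclusion *)

Lemma Psi1_XsubC (L : lmodType rat) (leL : rel L) (K : fieldType)
  (nu : {poly K} -> option L) (a : K) :
  nu 1 = Some 0 -> Psi leL nu 1 ('X - a%:P).
Proof.
move=> nu1; split; last by rewrite size_XsubC.
split; first exact: monicXsubC.
(* Here [f] is constant, of level [LMinf]; the level of 'X - a%:P is not, as its derivative 1 has
   value 0. *)
move=> f; rewrite size_XsubC ltnS {1}/level => ->.
rewrite /level size_XsubC /=; case: (nu _) => //= x.
by rewrite nderivn1 derivXsubC nu1 /levmax /=.
Qed.

Lemma Psi1_inv (L : lmodType rat) (leL : rel L) (K : fieldType)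
  (nu : {poly K} -> option L) (Q : {poly K}) :
  Psi leL nu 1 Q -> exists a, Q = 'X - a%:P.
Proof.
move=> [[/monicP mQ _] sQ]; exists (- Q`_0).
have s2 : size Q = 2%N by lia.
rewrite polyCN opprK; apply/polyP => -[|[|i]]; rewrite coefD coefX coefC /=.
- by rewrite add0r.
- by rewrite addr0 -mQ /lead_coef s2.
- by rewrite addr0 nth_default ?s2.
Qed.

Theorem mainTheorem18 (L : lmodType rat) (leL : rel L) (K : fieldType)
  (v : K -> option L) (nu : {poly K} -> option L)
  (Qs : {poly K} -> Prop) (F : {poly K}) :
  oag_axioms leL ->
  is_Kval leL v -> is_polyval leL nu -> (forall a : K, nu a%:P = v a) ->
  well_specified leL v nu ->
  (* m = 1 *)
  (exists Q, Psi leL nu 1 Q) ->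
  (forall Q, Psi leL nu 1 Q -> exists R, Psi leL nu 1 R /\ vlt leL (nu Q) (nu R)) ->
  (forall Q, Qs Q -> Psi leL nu 1 Q) ->
  family_well_ordered leL nu Qs ->
  (forall P, Psi leL nu 1 P -> exists Q, Qs Q /\ vle leL (nu P) (nu Q)) ->
  (exists f, ~ stable leL nu Qs f) ->
  KPinf leL nu Qs F ->
  (* Q vertically unbounded *)
  ~ vertically_bounded leL (cutQ_L leL v nu Qs) ->
  (* v(p) in H *)
  (forall p, res_char_exp leL v p ->
     exists h, v p%:R = Some h /\ invariance_group v (cutQ_L leL v nu Qs) h) ->
  (* d = 1 and B^ct = {1, ..., D} *)
  eventually leL nu Qs (fun Q => degQ leL nu Q F = 1%N) /\
  (forall l : nat, inBct leL v nu Qs 1 F l <-> (1 <= l <= Dnum 1 F)%N).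
Proof.
move=> OAG vP nuP nuC _ _ nomax QsPsi _ cofinal _ [monF [unstF minF]] unbdd vp.
have PsiX a : Psi leL nu 1 ('X - a%:P) by apply: Psi1_XsubC; apply: nu1 vP nuP nuC.
pose gam a := odflt 0 (nu ('X - a%:P)).
have nuX a : nu ('X - a%:P) = Some (gam a).
  (* An infinite value would be maximal. *)
  have [R [_]] := nomax _ (PsiX a); rewrite (vltE OAG) /gam.
  by case: (nu ('X - _)) => //; case: (nu R).
have gam_nomax a : exists b, ~~ leL (gam b) (gam a).
  have [R [/Psi1_inv[b ->]]] := nomax _ (PsiX a).
  by rewrite (vltE OAG) !nuX; exists b.
have QsX Q : Qs Q -> exists a, Q = 'X - a%:P by move=> /QsPsi /Psi1_inv.
have Qs_cof a : exists b, Qs ('X - b%:P) /\ leL (gam a) (gam b).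
  have [Q [QQ]] := cofinal _ (PsiX a); have [b Eb] := QsX Q QQ.
  by rewrite Eb !nuX => ab; exists b; rewrite -Eb.
have gam_cut a : cutQ_L leL v nu Qs (gam a).
  split.
    (* [gam a] is the value of b - a for a later [b], so it lies in the value group of [v]. *)
    have [b ab] := gam_nomax a; exists 1%N; split=> //; exists (b - a).
    by rewrite -nuC (nu_subC_eq OAG vP nuP nuC nuX ab).
  by have [b [Qb ab]] := Qs_cof a; exists ('X - b%:P); rewrite nuX.
have cut_gam x : cutQ_L leL v nu Qs x -> exists b, leL x (gam b).
  move=> [_ [Q [/QsX[b ->]]]]; by rewrite nuX; exists b.
(* Vertical boundedness fails at some [x0] and [q]; since the order is total and the [gam b] are
   cofinal in the cut, dilation by [q] about [x0] preserves the cut. *)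
have [x0 cx0 [q q1 qP]] : exists2 x0, cutQ_L leL v nu Qs x0 &
    exists2 q : rat, 1 < q &
      forall b, exists c, leL (q *: (gam b - x0)) (gam c - x0).
  apply: NNPP => H; apply: unbdd => x cx q q1; apply: NNPP => H1; apply: H.
  exists x => //; exists q => // b; apply: NNPP => H2; apply: H1.
  exists (gam b); split=> // z /cut_gam[c zc].
  have : ~~ leL (q *: (gam b - x)) (z - x).
    apply/negP => h; apply: H2; exists c.
    by apply: (oag_trans OAG) h _; rewrite (leL_add2r OAG).
  move=> h; rewrite /ltL (nleL_le OAG h) /=.
  by apply: contra h => /eqP ->; apply: (oag_refl OAG).
have cut0 : in_shifted_cut leL gam x0 0.
  by have [b xb] := cut_gam _ cx0; exists b; rewrite addr0.
have cutD := in_shifted_cutD OAG q1 qP cut0.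
have natcut := nu_nat_in_cut OAG vP nuP nuC cut0 cutD.
have {}natcut k : (0 < k)%N ->
    exists2 c, nu k%:R = Some c & in_shifted_cut leL gam x0 c.
  apply: natcut => p pp np; rewrite -polyC_natr nuC -(vltE OAG) in np.
  (* A prime of positive value is the residue characteristic; its value [h] lies in H, so h + x0
     stays in the cut. *)
  have [|h [Eh [_ Hh]]] := vp p; first by left.
  exists h; first by rewrite -polyC_natr nuC.
  have [|b hb] := cut_gam (h + x0); first by apply/Hh; exists x0.
  by exists b; rewrite addrC.
split; first exact: (degQ_limit OAG vP nuP nuC nuX gam_nomax QsX Qs_cof
  cut0 cutD natcut monF unstF minF).
exact: (inBct_limit OAG vP nuP nuC nuX gam_nomax QsX Qs_cof
  cut0 cutD natcut monF unstF minF).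
Qed.
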